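(* Let $I \subset R = K[\mathcal{A}]$ be a square-free monomial ideal and let $\mathcal{H} = \mathcal{H}(I) = (V, X, E, \mathcal{E})$ be its labeled hypergraph. Suppose that there are vertices $v_1,\ldots,v_t\in V$ such that adding the edges $\{v_1\},\ldots,\{v_t\}$ of size $1$ to $\mathcal{E}$ yields a new hypergraph with isolated open vertices. Then \[\mathrm{reg}(R/I) \le |X| - |V| + t.\]
   Context: $K$ is a field, $\mathcal{A}$ is a finite set of symbols regarded as variables, and $R = K[\mathcal{A}]$ is the polynomial ring with the standard grading (every variable has degree one). For a finitely generated graded $R$-module $M$ with graded Betti numbers $\beta_{ij}(M)$ (so that the $i$th module of the minimal graded free resolution is $\bigoplus_j R(-j)^{\beta_{ij}(M)}$), $\mathrm{reg}(M) = \max\{j-i : \beta_{ij}(M)\neq 0 \text{ for some } i\}$. Labeled hypergraph of an ideal: let $I\subset R$ be a square-free monomial ideal with minimal monomial generating set $\{f_1,\ldots,f_\mu\}$. Its labeled hypergraph is $\mathcal{H}(I) = (V,X,E,\mathcal{E})$ where $V = \{1,\ldots,\mu\}$; $E$ is the function from $\mathcal{A}$ to the power set of $V$ given by $E_a = E(a) = \{j : a \text{ divides } f_j\}$; $X = \{a\in\mathcal{A} : E_a\neq\emptyset\}$; and $\mathcal{E} = \mathrm{Im}(E)$ is the set of edges. A vertex $v\in V$ is closed if $\{v\}$ is an edge, and open otherwise. The set of neighbors of $v$ is $N_{\mathcal{H}}(v) = \{w\in V : w\neq v \text{ and there is an edge } F \text{ with } v,w\in F\}$. A hypergraph has isolated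 open vertices if for every open vertex $v$ and every neighbor $w$ of $v$, $w$ is closed. The new hypergraph in the claim has the same vertex set $V$ and edge set $\mathcal{E}\cup\{\{v_1\},\ldots,\{v_t\}\}$; the quantities $|X|$ and $|V|$ in the bound refer to the original hypergraph $\mathcal{H}(I)$. *)

(* Defs.v *)
From HB Require Import structures.
From mathcomp Require Import all_boot all_order all_algebra.
From mathcomp Require Import ring_quotient mpoly.
From mathcomp Require Import boolp classical_sets constructive_ereal.

Set Implicit Arguments.
Unset Strict Implicit.
Unset Printing Implicit Defensive.

Import Order.TTheory GRing.Theory Num.Theory.
Local Open Scope ring_scope.
Local Open Scope quotient_scope.

Section QuotientModule.
Context {R : nzRingType} {V : lmodType R} (S : submodClosed V).

(* MathComp does not equip a submodClosed predicate with the zmodClosed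
   structure that Quotient.quot expects; this alias carries it. *)
Definition submod_zmod : {pred V} := S.

Fact submod_zmod_closed : zmod_closed submod_zmod.
Proof. exact: GRing.submod_closedB (submodClosedP S). Qed.

HB.instance Definition _ :=
  GRing.isZmodClosed.Build V submod_zmod submod_zmod_closed.

Definition quotmod : Type := Quotient.quot submod_zmod.
HB.instance Definition _ := GRing.Zmodule.on quotmod.

Definition quotmod_pi (x : V) : quotmod := \pi_(Quotient.quot submod_zmod) x.

Definition quotmod_scale (a : R) (x : quotmod) : quotmod :=
  quotmod_pi (a *: repr (x : Quotient.quot submod_zmod)).

Lemma quotmod_piP (x y : V) : quotmod_pi x = quotmod_pi y <-> x - y \in S.
Proof.
by split=> [/eqP|h]; [|apply/eqP];
  rewrite /quotmod_pi -Quotient.idealrBE.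
Qed.

Lemma quotmod_repr (x : quotmod) :
  quotmod_pi (repr (x : Quotient.quot submod_zmod)) = x.
Proof. exact: reprK. Qed.

Lemma quotmod_piD (x y : V) :
  quotmod_pi (x + y) = quotmod_pi x + quotmod_pi y.
Proof. by rewrite /quotmod_pi raddfD. Qed.

Lemma quotmod_piZ (a : R) (x : V) :
  quotmod_scale a (quotmod_pi x) = quotmod_pi (a *: x).
Proof.
apply/quotmod_piP; rewrite -scalerBr; apply: rpredZ.
by apply/quotmod_piP; rewrite quotmod_repr.
Qed.

Fact quotmod_scalerA a b (x : quotmod) :
  quotmod_scale a (quotmod_scale b x) = quotmod_scale (a * b) x.
Proof. by rewrite -[x]quotmod_repr !quotmod_piZ scalerA. Qed.

Fact quotmod_scale1r : left_id 1 quotmod_scale.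
Proof. by move=> x; rewrite -[x]quotmod_repr quotmod_piZ scale1r. Qed.

Fact quotmod_scalerDr : right_distributive quotmod_scale +%R.
Proof.
move=> a x y; rewrite -[x]quotmod_repr -[y]quotmod_repr.
by rewrite -quotmod_piD !quotmod_piZ scalerDr quotmod_piD.
Qed.

Fact quotmod_scalerDl (x : quotmod) :
  {morph quotmod_scale^~ x : a b / a + b}.
Proof.
by move=> a b /=; rewrite -[x]quotmod_repr !quotmod_piZ scalerDl quotmod_piD.
Qed.

HB.instance Definition _ := GRing.Zmodule_isLmodule.Build R quotmod
  quotmod_scalerA quotmod_scale1r quotmod_scalerDr quotmod_scalerDl.

End QuotientModule.

Record labeled_hypergraph (A : finType) := LabeledHypergraph {
  lh_V : finType;
  lh_E : A -> {set lh_V}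
}.

Definition lh_X (A : finType) (H : labeled_hypergraph A) : {set A} :=
  [set a | lh_E H a != finset.set0]%SET.

Definition lh_edges (A : finType) (H : labeled_hypergraph A) :
    {set {set lh_V H}} :=
  [set lh_E H a | a in A]%SET.

Section Hypergraph.
Context {V : finType} (Es : {set {set V}}).

Definition closed_vertex (v : V) : bool := [set v]%SET \in Es.
Definition open_vertex (v : V) : bool := ~~ closed_vertex v.

Definition neighbors (v : V) : {set V} :=
  [set w | (w != v) && [exists F in Es, (v \in F) && (w \in F)]]%SET.

Definition isolated_open_vertices : Prop :=
  forall v w, open_vertex v -> w \in neighbors v -> closed_vertex w.

Definition add_singletons (t : nat) (v : 'I_t -> V) : {set {set V}} :=
  (Es :|: [set [set v i] | i in 'I_t])%SET.

End Hypergraph.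

Local Open Scope classical_set_scope.

Section Ideals.
Context {K : fieldType} {n : nat}.
Local Notation R := {mpoly K[n]}.

(* An ideal of R is a submodule of the regular module R^o. *)
Definition generates (G : set R) (I : submodClosed R^o) : Prop :=
  forall p : R, p \in I <->
    exists k (c g : 'I_k -> R), (forall i, G (g i)) /\ p = \sum_i c i * g i.

Definition squarefree_mon (m : 'X_{1..n}) : bool := [forall a, (m a <= 1)%N].

Definition squarefree_monomial_ideal (I : submodClosed R^o) : Prop :=
  exists G : set 'X_{1..n}, (forall m, G m -> squarefree_mon m) /\
    generates [set 'X_[m] | m in G] I.

Definition min_monomial_generators (I : submodClosed R^o) (mu : nat)
    (f : 'I_mu -> 'X_{1..n}) : Prop :=
  generates [set 'X_[f j] | j in [set: 'I_mu]] I /\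
  forall S : {set 'I_mu},
    generates [set 'X_[f j] | j in [set` S]] I -> S = finset.setT.

Definition ideal_hypergraph (mu : nat) (f : 'I_mu -> 'X_{1..n}) :
    labeled_hypergraph 'I_n :=
  LabeledHypergraph (fun a => [set j | (U_(a) <= f j)%MM]%SET).

End Ideals.

Section Regularity.
Context {K : fieldType} {n : nat}.
Local Notation R := {mpoly K[n]}.

Definition homog_of_degree (d : int) (p : R) : bool :=
  match d with Posz k => p \is k.-homog | Negz _ => p == 0 end.

(* M is graded by gr, gr d being its component of degree d.  The i-th free
   module is the space of row vectors 'rV[R]_(res_rank i), whose k-th basis
   vector has degree res_deg k, i.e. it is the direct sum over k of the
   R(- res_deg k); the matrices act on the right. *)
Record min_free_resolution (M : lmodType R) (gr : int -> set M) := {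
  res_rank : nat -> nat;
  res_deg : forall i, 'I_(res_rank i) -> int;
  res_diff : forall i, 'M[R]_(res_rank i.+1, res_rank i);
  res_aug : {linear 'rV[R]_(res_rank 0) -> M};
  res_diff_homog : forall i k l,
    homog_of_degree (res_deg k - res_deg l) (res_diff i k l);
  res_aug_homog : forall k, gr (res_deg k) (res_aug (delta_mx 0 k));
  res_aug_surj : forall x, exists u, res_aug u = x;
  res_aug_exact : forall u,
    res_aug u = 0 <-> exists w, u = w *m res_diff 0;
  res_diff_exact : forall i (u : 'rV_(res_rank i.+1)),
    u *m res_diff i = 0 <-> exists w, u = w *m res_diff i.+1;
  (* the image of each differential lies in (x_1, ..., x_n) F_i *)
  res_minimal : forall i k l, (res_diff i k l)@_0%MM = 0
}.
Arguments res_deg {M gr} F i k : rename.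

(* A minimal graded free resolution of a finitely generated graded module
   exists and is unique up to isomorphism, so that the set below is a
   singleton. *)
Definition betti (M : lmodType R) (gr : int -> set M) (i : nat) (j : int) :
    nat :=
  xget 0%N [set b | exists F : min_free_resolution gr,
    b = #|[set k : 'I_(res_rank F i) | res_deg F i k == j]%SET|].

(* This is a maximum for a finitely generated nonzero module, and -oo for the
   zero module. *)
Definition reg (M : lmodType R) (gr : int -> set M) : \bar int :=
  supremum -oo%E
    [set z | exists i j, betti gr i j != 0%N /\ z = (j - i%:Z)%:E].

Definition quot_grading (I : submodClosed R^o) (d : int) : set (quotmod I) :=
  [set quotmod_pi I p | p in [set p : R^o | homog_of_degree d p]].

End Regularity.

(* Main.v *)
From HB Require Import structures.
Require Import Defs.
From mathcomp Require Import all_boot all_order all_algebra.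
From mathcomp Require Import ring_quotient mpoly zify.
From mathcomp Require Import boolp classical_sets constructive_ereal.
From mathcomp Require Import fintype finset.

(** Let F be a minimal graded free resolution of R/I.  A basis vector of degree
    d in F_i survives in Tor_i(R/I, K), and Tor can also be computed from the
    Koszul complex of the variables; so it suffices that the homology
    H_i(x_1, ..., x_n; R/I) vanishes in internal degree d as soon as
    d - i > |X| - |V| + t.  The passage from F to the Koszul complex is the
    zigzag in the double complex of F and the Koszul complex (lemma [zigzag]):
    it only uses that the Koszul complex of R is exact ([koszul_exact]), so
    that no other resolution ever has to be built or compared with F.

    The Koszul complex of R/I is the direct sum of its strands, one for each
    multidegree g.  If T is the support of g, the strand of g has a basis
    indexed by those B included in T for which x^(g - 1_B) is not in I, that
    is, for square-free g, those B for which T \ B contains the support of no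
    generator.  Three facts about a strand give the bound.
    - Any variable a such that B can be replaced by B \ a throughout the index
      family contracts the strand ([cone_exact]).  This disposes of the
      multidegrees which are not square-free and of the variables outside X.
    - Let C be the set of closed vertices of H(I), each of which has a private
      variable c_v occurring in the generator f_v only.  The partial
      contractions along the c_v do not disturb one another, so that every
      cycle is homologous to one supported on those B which contain every c_v
      lying in T ([clean_seq]).
    - Let O be the set of vertices which stay open in the new hypergraph; the
      supports of the f_v, for v in O, are pairwise disjoint and avoid the c_w.
      For B as in the previous item, T \ B misses the |C| variables c_v and,
      as it contains the support of no generator, one variable of f_v for each
      v in O; hence |T \ B| <= |X| - |C| - |O|.
    Since |T \ B| = d - i and |V| <= |C| + |O| + t, the strand has no homology
    in the range above. *)

Import Order.TTheory GRing.Theory Num.Theory.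

Set Implicit Arguments.
Unset Strict Implicit.
Unset Printing Implicit Defensive.
Local Open Scope ring_scope.

(** * Contracting the strands of a Koszul complex *)

Section Strand.
Context {K : pzRingType} {n : nat}.
Implicit Types (a b c : 'I_n) (B T : {set 'I_n}) (u y : {set 'I_n} -> K).

(** The exponent of the Koszul sign attached to inserting [a] into [B]. *)
Definition rank_in a B : nat := #|[set b in B | (b < a)%N]|.

Lemma rank_inU a b B : b \notin B ->
  rank_in a (b |: B) = ((b < a)%N + rank_in a B)%N.
Proof.
move=> bB; rewrite /rank_in; case: ltnP => ba.
  rewrite -[RHS](_ : #|b |: [set x in B | (x < a)%N]| = _); last first.
    by rewrite cardsU1 inE (negPf bB).
  apply: eq_card => x; rewrite !inE.
  by case: eqVneq => [->|].
apply: eq_card => x; rewrite !inE.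
by case: eqVneq => [->|//]; rewrite ltnNge ba (negPf bB).
Qed.

(** Chains are functions on all subsets; the complex that is meant is the one
    spanned by the [B] satisfying a predicate closed under enlarging [B] inside
    [T], and only the values at such [B] matter. *)
Definition bd T u B : K :=
  \sum_(a in T :\: B) (-1) ^+ rank_in a B * u (a |: B).

Lemma sum_antisym (A : {set 'I_n}) (F : 'I_n -> 'I_n -> K) :
  (forall a b, a \in A -> b \in A -> (a < b)%N -> F a b = - F b a) ->
  \sum_(a in A) \sum_(b in A :\ a) F a b = 0.
Proof.
move=> FN.
have -> : \sum_(a in A) \sum_(b in A :\ a) F a b =
    \sum_(a in A) \sum_(b in A | (a < b)%N) F a b
  + \sum_(a in A) \sum_(b in A | (b < a)%N) F a b.
  rewrite -big_split; apply: eq_bigr => a aA /=.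
  rewrite (bigID (fun b : 'I_n => (a < b)%N)) /=.
  congr (_ + _); apply: eq_bigl => b; rewrite !inE -val_eqE /=;
  by case: (b \in A) => //; lia.
have -> : \sum_(a in A) \sum_(b in A | (b < a)%N) F a b =
    \sum_(a in A) \sum_(b in A | (a < b)%N) F b a.
  rewrite (exchange_big_dep (mem A)) => [|a b _ /andP[]//] /=.
  by apply: eq_bigr => a aA; apply: eq_bigl => b; rewrite aA.
rewrite -big_split big1 // => a aA /=.
rewrite -big_split big1 // => b /andP[bA ab] /=.
by rewrite FN // addNr.
Qed.

(** Inserting [a] and then [b] or [b] and then [a] gives opposite signs. *)
Lemma bd_bd T u B : bd T (bd T u) B = 0.
Proof.
rewrite /bd.
under eq_bigr => a _ do rewrite big_distrr /=.
transitivity (\sum_(a in T :\: B) \sum_(b in (T :\: B) :\ a)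
   (-1) ^+ (rank_in a B + rank_in b (a |: B)) * u (b |: (a |: B))).
  apply: eq_bigr => a; rewrite inE => /andP[aB aT].
  apply: eq_big => b; last by move=> _; rewrite mulrA exprD.
  by rewrite !inE negb_or andbA.
apply: sum_antisym => a b; rewrite !inE => /andP[aB aT] /andP[bB bT] ab.
rewrite [rank_in b _]rank_inU // [rank_in a (b |: B)]rank_inU // ab.
rewrite ltnNge ltnW //= add0n add1n addnS exprS mulN1r mulNr setUCA.
by rewrite [X in _ ^+ X]addnC.
Qed.

Lemma eq_bd T u y B : (forall a, a \in T :\: B -> u (a |: B) = y (a |: B)) ->
  bd T u B = bd T y B.
Proof. by move=> e; apply: eq_bigr => a /e ->. Qed.

Lemma bdD T u y B : bd T (fun B => u B + y B) B = bd T u B + bd T y B.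
Proof. by rewrite -big_split; apply: eq_bigr => a _; rewrite mulrDr. Qed.

Lemma bdB T u y B : bd T (fun B => u B - y B) B = bd T u B - bd T y B.
Proof. by rewrite -sumrB; apply: eq_bigr => a _; rewrite mulrBr. Qed.

Lemma bd_single T u B c : c \in T -> c \notin B ->
    (forall a, a \in T -> a \notin B -> a != c -> u (a |: B) = 0) ->
  bd T u B = (-1) ^+ rank_in c B * u (c |: B).
Proof.
move=> cT cB u0; rewrite /bd (bigD1 c) /=; last by rewrite inE cB.
rewrite big1 ?addr0 // => a; rewrite inE => /andP[/andP[aB aT] ac].
by rewrite u0 ?mulr0.
Qed.

Lemma rank_signK c B (x : K) :
  (-1) ^+ rank_in c B * ((-1) ^+ rank_in c B * x) = x.
Proof. by rewrite mulrA -exprD addnn -mul2n exprM sqrrN !expr1n mul1r. Qed.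

Context (T : {set 'I_n}) (P : pred {set 'I_n}).
Hypothesis PT : forall B, P B -> B \subset T.
Hypothesis Pup : forall B B', P B -> B \subset B' -> B' \subset T -> P B'.

Let PU a B : P B -> a \in T -> P (a |: B).
Proof.
move=> PB aT; apply: (Pup PB); rewrite ?subsetU1 //.
by rewrite subUset sub1set aT PT.
Qed.

Definition cycle_on u := forall B, P B -> bd T u B = 0.

(** The contracting homotopy along the variable [c], set to 0 where it would
    leave the complex spanned by [P]. *)
Definition clean c u B : K :=
  if (c \in B) && P (B :\ c) then (-1) ^+ rank_in c (B :\ c) * u (B :\ c)
  else 0.

Lemma cycle_sub_bd u y : cycle_on u -> cycle_on (fun B => u B - bd T y B).
Proof. by move=> cu B PB; rewrite bdB cu // bd_bd subr0. Qed.

(** The correction kills the value at [B] not containing [c] by construction.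
    For [B] containing [c], the cycle condition at [B :\ c] involves, besides
    [B], only sets without [c], so that the value at [B] vanishes as well. *)
Lemma clean_vanish c u B : c \in T -> cycle_on u -> P B -> P (B :\ c) ->
  u B - bd T (clean c u) B = 0.
Proof.
move=> cT cu; set u' := fun B => u B - bd T (clean c u) B.
rewrite -[LHS]/(u' B).
have clean_out B0 : P B0 -> c \notin B0 -> u' B0 = 0.
  move=> PB0 cB0; rewrite /u' (bd_single cT cB0) => [|a aT aB0 ac].
    by rewrite /clean setU11 setU1K // PB0 /= rank_signK subrr.
  by rewrite /clean !inE eq_sym (negPf ac) (negPf cB0).
move=> PB PBc; case: (boolP (c \in B)) => cB; last exact: clean_out.
have := cycle_sub_bd (clean c u) cu PBc.
rewrite (bd_single (c := c)) ?setD1K // ?inE ?eqxx // => [e|a aT aB ac].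
  by rewrite -[LHS](rank_signK c (B :\ c)) e mulr0.
by apply: clean_out; rewrite ?PU // !inE eq_sym (negPf ac) eqxx.
Qed.

Lemma cone_exact c u : c \in T -> (forall B, P B -> P (B :\ c)) ->
  cycle_on u -> exists y, forall B, P B -> u B = bd T y B.
Proof.
move=> cT Pc cu; exists (clean c u) => B PB; apply/subr0_eq.
exact: (clean_vanish cT cu PB (Pc _ PB)).
Qed.

(** The exchange condition says that cleaning along [c] does not destroy what
    cleaning along [c'] has achieved: the correction at [B] only involves the
    values at sets of the form [(a |: B) :\ c], which already vanish when [c']
    can be removed from them. *)
Lemma clean_seq (L : seq 'I_n) u : {subset L <= T} ->
  {in L &, forall c c', c != c' -> forall B a, P B -> P (B :\ c') ->
     a \notin B -> P ((a |: B) :\ c) -> P (((a |: B) :\ c) :\ c')} ->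
  cycle_on u ->
  exists y, forall B c, P B -> c \in L -> P (B :\ c) -> u B = bd T y B.
Proof.
move=> + + cu; elim: L => [|c L IH] LT exL; first by exists u.
have [||y yP] := IH.
- by move=> a aL; apply: LT; rewrite inE aL orbT.
- by move=> a b aL bL; apply: exL; rewrite inE ?aL ?bL orbT.
pose u' B := u B - bd T y B.
have cu' : cycle_on u' by apply: cycle_sub_bd.
have cT : c \in T by apply: LT; rewrite mem_head.
exists (fun B => y B + clean c u' B) => B c' PB.
rewrite bdD inE; have [-> _ PBc|nc /= c'L PBc'] := eqVneq c' c.
  apply/subr0_eq; rewrite opprD addrA.
  exact: (clean_vanish cT cu' PB PBc).
rewrite -(yP B c') // [X in _ + X]big1 ?addr0 // => a.
rewrite !inE => /andP[aB aT].
rewrite /clean; case: ifP => [/andP[caB Pca]|_]; last by rewrite mulr0.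
rewrite /u' (yP _ c') // ?subrr ?mulr0 //.
by apply: exL; rewrite ?mem_head // ?inE ?c'L ?orbT // eq_sym.
Qed.

End Strand.

Section StrandVanish.
Context {K : pzRingType} {n mu : nat}.
Context (s : 'I_mu -> {set 'I_n}) (X : {set 'I_n}).
Context (C O : {set 'I_mu}) (c : 'I_mu -> 'I_n).
Hypothesis sX : forall j, s j \subset X.
Hypothesis cP : {in C, forall v j, (c v \in s j) = (j == v)}.
Hypothesis Odisj : {in O &, forall v w : 'I_mu, v != w -> [disjoint s v & s w]}.
Hypothesis CO : [disjoint C & O].

(** For [s j] the support of the [j]-th generator, this says that the product
    of the variables in [A] is a standard monomial. *)
Definition no_gen (A : {set 'I_n}) : bool := [forall j, ~~ (s j \subset A)].

Definition strand (T : {set 'I_n}) : pred {set 'I_n} :=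
  fun B => (B \subset T) && no_gen (T :\: B).

Lemma no_genS (A A' : {set 'I_n}) : A \subset A' -> no_gen A' -> no_gen A.
Proof.
move=> AA' /forallP h; apply/forallP => j; apply: contra (h j) => /subset_trans.
exact.
Qed.

Lemma strandT T (B : {set 'I_n}) : strand T B -> B \subset T.
Proof. by case/andP. Qed.

Lemma strand_up T (B B' : {set 'I_n}) :
  strand T B -> B \subset B' -> B' \subset T -> strand T B'.
Proof.
move=> /andP[BT h] BB' B'T; rewrite /strand B'T.
by apply: no_genS h; apply: setDS.
Qed.

Lemma strandD1 (T B : {set 'I_n}) a : a \in T ->
  strand T B -> (forall j, a \in s j -> ~~ (s j \subset a |: (T :\: B))) ->
  strand T (B :\ a).
Proof.
move=> aT /andP[BT /forallP h] ha; apply/andP; split.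
  exact: subset_trans (subD1set _ _) BT.
have sub : T :\: (B :\ a) \subset a |: (T :\: B).
  by apply/subsetP => x; rewrite !inE; case: eqVneq.
apply/forallP => j; case: (boolP (a \in s j)) => aj.
  by apply: contra (ha j aj) => /subset_trans; apply.
apply: contra (h j) => jT; apply/subsetP => x xj.
have := subsetP (subset_trans jT sub) x xj; rewrite !inE.
by case: eqVneq xj => // ->; rewrite (negPf aj).
Qed.

(** For [B] with |T \ B| too large, some private variable [c v] can be removed
    from [B], so that cleaning along all private variables kills the cycle at
    [B].  Otherwise the [c v], for [v] in [C], and a variable of [s v] outside
    [T :\: B], for each [v] in [O], would be |C| + |O| distinct elements of
    [X] outside [T :\: B]. *)
Lemma strand_vanish T (u : {set 'I_n} -> K) : cycle_on T (strand T) u ->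
  exists y, forall B, strand T B ->
    (#|X| < #|T :\: B| + #|C| + #|O|)%N -> u B = bd T y B.
Proof.
move=> cu.
have [TX|] := boolP (T \subset X); last first.
  (* a variable of T dividing no generator contracts the whole strand *)
  case/subsetPn => a aT aX.
  have [y yP] : exists y, forall B, strand T B -> u B = bd T y B.
    apply: (@cone_exact _ _ T (strand T) _ _ a) => //.
    - exact: strandT.
    - exact: strand_up.
    - move=> B PB; apply: strandD1 => // j aj.
      by move: aX; rewrite (subsetP (sX j)).
  by exists y => B PB _; apply: yP.
pose L := [seq c v | v <- enum C & c v \in T].
have LP a : a \in L -> exists2 v, v \in C & a = c v /\ c v \in T.
  by case/mapP => v; rewrite mem_filter mem_enum => /andP[vT vC] ->; exists v.
have [||||y yP] := @clean_seq _ _ T (strand T) _ _ L u _ _ cu.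
- exact: strandT.
- exact: strand_up.
- by move=> a /LP[v _ [->]].
- move=> _ _ /LP[v vC [-> vT]] /LP[w wC [-> wT]] vw B a PB PBw aB PB1.
  have nvw : v != w by apply: contraNneq vw => ->.
  apply: strandD1 => // j; rewrite cP // => /eqP -> {j}.
  (* c w belongs to s w only, so that s w, which does not contain c v, is the
     generator to be excluded *)
  case/andP: PBw => _ /forallP /(_ w); apply: contra => h.
  apply/subsetP => x xw; have := subsetP h x xw.
  have xv : x != c v.
    by apply: contraNneq nvw => xv; move: xw; rewrite xv cP // eq_sym.
  rewrite !inE xv /=; case: eqVneq => [->|]; first by rewrite wT.
  by rewrite negb_or => _ /= /andP[/andP[_ ->] ->].
exists y => B PB; rewrite ltnNge => /negP h.
have [|noL] := boolP [exists v in C, (c v \in T) && strand T (B :\ c v)].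
  case/existsP => v /and3P[vC vT Pv]; apply: (yP _ (c v)) => //.
  by apply: map_f; rewrite mem_filter mem_enum vT.
case: h.
have cB v : v \in C -> c v \notin T :\: B.
  move=> vC; rewrite inE negb_and negbK; case: (boolP (c v \in T)) => vT.
    2: by rewrite orbT.
  rewrite orbF; apply: contraNT noL => vB; apply/existsP; exists v.
  rewrite vC vT; suff -> : B :\ c v = B by [].
  by apply/setDidPl; rewrite disjoints_subset; apply/subsetP => x xB;
     rewrite !inE; apply: contraNneq vB => <-.
have oP v : exists a, v \in O -> (a \in s v) && (a \notin T :\: B).
  case: (boolP (v \in O)) => vO; last by exists (c v).
  case/andP: PB => _ /forallP /(_ v) /subsetPn[a av aB].
  by exists a; rewrite av aB.
have [o {}oP] := choice oP.
pose g v := if v \in C then c v else o v.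
have gs v : v \in C :|: O -> (g v \in s v) && (g v \notin T :\: B).
  rewrite inE /g; case: ifP => [vC _|_ /=]; last exact: oP.
  by rewrite cP // eqxx cB.
have ginj : {in C :|: O &, injective g}.
  move=> v w vCO wCO e; apply/eqP/negPn/negP => nvw.
  have /andP[gv _] := gs v vCO; have /andP[gw _] := gs w wCO.
  have [vC|vC] := boolP (v \in C).
    by move: gw; rewrite -e /g vC cP // eq_sym (negPf nvw).
  have [wC|wC] := boolP (w \in C).
    by move: gv; rewrite e /g wC cP // (negPf nvw).
  have vO : v \in O by move: vCO; rewrite inE (negPf vC).
  have wO : w \in O by move: wCO; rewrite inE (negPf wC).
  have := Odisj vO wO nvw; rewrite disjoints_subset.
  by move/subsetP/(_ _ gv); rewrite inE e gw.
have := card_in_imset ginj; rewrite cardsU.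
have -> : C :&: O = set0 by apply/eqP; rewrite setI_eq0.
rewrite cards0 subn0 -addnA => <-.
have <- : #|(T :\: B) :|: g @: (C :|: O)| = (#|T :\: B| + #|g @: (C :|: O)|)%N.
  rewrite cardsU (_ : _ :&: _ = set0) ?cards0 ?subn0 //.
  apply/eqP; rewrite setI_eq0 disjoint_sym disjoints_subset.
  by apply/subsetP => _ /imsetP[v vCO ->]; have /andP[] := gs v vCO;
     rewrite in_setC.
apply: subset_leq_card; rewrite subUset (subset_trans (subsetDl _ _) TX) /=.
apply/subsetP => _ /imsetP[v vCO ->].
by have /andP[gv _] := gs v vCO; apply: (subsetP (sX v)).
Qed.

End StrandVanish.

(** * Koszul complexes of modules over the polynomial ring *)

Section Koszul.
Context {K : fieldType} {n : nat}.
Local Notation R := {mpoly K[n]}.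
Implicit Types (a b c : 'I_n) (B T : {set 'I_n}) (m : 'X_{1..n}).

(** The differential of the Koszul complex of the variables on [V]; a chain
    gives the coefficient of each exterior basis vector e_B. *)
Definition koszul (V : lmodType R) (w : {set 'I_n} -> V) B : V :=
  \sum_(a | a \notin B) ((-1) ^+ rank_in a B * 'X_a) *: w (a |: B).

Lemma koszul_linear (V W : lmodType R) (g : V -> W) w B : linear g ->
  g (koszul w B) = koszul (fun B => g (w B)) B.
Proof.
move=> gl; pose G : {linear V -> W} :=
  HB.pack g (GRing.isLinear.Build _ _ _ _ g gl).
rewrite -[g]/(G : _ -> _) linear_sum.
by apply: eq_bigr => a _; rewrite linearZ.
Qed.

Lemma koszulB (V : lmodType R) (w w' : {set 'I_n} -> V) B :
  koszul (fun B => w B - w' B) B = koszul w B - koszul w' B.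
Proof. by rewrite -sumrB; apply: eq_bigr => a _; rewrite scalerBr. Qed.

Lemma eq_koszul (V : lmodType R) (w w' : {set 'I_n} -> V) B :
  w =1 w' -> koszul w B = koszul w' B.
Proof. by move=> e; apply: eq_bigr => a _; rewrite e. Qed.

Lemma mcoeffXM m' (p : R) m :
  ('X_[m'] * p)@_m = if (m' <= m)%MM then p@_(m - m') else 0.
Proof.
rewrite -commr_mpolyX; case: ifP => [mm'|nm].
  by rewrite -{1}(submK mm') addmC mcoeffMX.
rewrite mcoeffMr big1 // => -[k1 k2] /= /eqP e; rewrite mcoeffX.
case: eqVneq => [e1|]; last by rewrite mulr0.
by case/negP: (negbT nm); rewrite e1 [X in (_ <= X)%MM]e lem_addr.
Qed.

Definition mnmsupp m : {set 'I_n} := [set a | (0 < m a)%N].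

Lemma mesym1_supp B m : (mesym1 B <= m)%MM = (B \subset mnmsupp m).
Proof.
apply/mnm_lepP/subsetP => [h a aB|h a].
  by rewrite inE; have := h a; rewrite mnmE aB.
by rewrite mnmE; case: (boolP (a \in B)) => // /h; rewrite inE.
Qed.

(** The differential preserves the multidegree [m + mesym1 B], which reduces
    computations to the strands. *)
Lemma koszul_coef (z : {set 'I_n} -> R^o) B m :
  (koszul z B : R)@_m = bd (mnmsupp (m + mesym1 B))
     (fun B' => (z B')@_(m + mesym1 B - mesym1 B')) B.
Proof.
rewrite raddf_sum /=; apply/esym.
rewrite /bd big_mkcond [RHS]big_mkcond /=; apply: eq_bigr => a _.
rewrite !inE mnmDE mnmE; case: (boolP (a \in B)) => //= aB; rewrite addn0.
have -> : ((-1) ^+ rank_in a B * 'X_a : R) *: (z (a |: B) : R^o) =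
    ((-1) ^+ rank_in a B : K)%:MP * ('X_a * z (a |: B)).
  by rewrite mulrA rmorph_sign.
rewrite mcoeffCM mcoeffXM.
have -> : (U_(a) <= m)%MM = (0 < m a)%N.
  by rewrite -mesym1_set1 mesym1_supp sub1set inE.
case: ifP => ma; last by rewrite mulr0.
congr (_ * mcoeff _ _); apply/mnmP => b.
rewrite !(mnmBE, mnmDE, mnmE) !inE (eq_sym a b).
by case: (eqVneq b a) => [->|]; rewrite ?(negPf aB) //= ?add0n;
   case: (b \in B); lia.
Qed.

(** Chains of homological degree [s] and internal degree [D], where e_B has
    internal degree #|B|. *)
Definition hchain (D : int) (s : nat) (z : {set 'I_n} -> R) : Prop :=
  forall B m, (z B)@_m != 0 -> #|B| = s /\ (mdeg m + s)%:Z = D.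

(** A chain is a boundary modulo the nonstandard monomials as soon as each of
    its strands is one; only finitely many multidegrees of degree [D] occur, so
    that the solutions in the strands assemble into polynomials. *)
Lemma koszul_lift (std : pred 'X_{1..n}) D s (z : {set 'I_n} -> R^o) :
    hchain D s z ->
    (forall g : 'X_{1..n}, (mdeg g)%:Z = D -> exists y : {set 'I_n} -> K,
      forall B, #|B| = s -> B \subset mnmsupp g -> std (g - mesym1 B)%MM ->
        (z B)@_(g - mesym1 B) = bd (mnmsupp g) y B) ->
  exists2 q : {set 'I_n} -> R^o, hchain D s.+1 q &
    forall B m, std m -> (z B)@_m = (koszul q B : R)@_m.
Proof.
move=> hz hg.
have /choice[y yP] : forall g, exists y : {set 'I_n} -> K,
    (mdeg g)%:Z = D -> forall B, #|B| = s -> B \subset mnmsupp g ->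
    std (g - mesym1 B)%MM -> (z B)@_(g - mesym1 B) = bd (mnmsupp g) y B.
  move=> g; have [/hg [y yP]|ne] := eqVneq (mdeg g)%:Z D; first by exists y.
  by exists (fun _ => 0) => e; rewrite e eqxx in ne.
pose co B m : K := if (#|B| == s.+1) && ((mdeg m + s.+1)%:Z == D)
  then y (m + mesym1 B)%MM B else 0.
pose q B : R := \sum_(m : 'X_{1..n < (absz D).+1}) co B m *: 'X_[m].
have qE B m : (q B)@_m = co B m.
  have [lt|ge] := ltnP (mdeg m) (absz D).+1; first by rewrite mcoeff_mpoly.
  have -> : co B m = 0.
    by rewrite /co; case: ifP => // /andP[_ /eqP e]; move: ge; lia.
  rewrite raddf_sum big1 // => k _; rewrite /= mcoeffZ mcoeffX.
  case: eqVneq => [e|]; last by rewrite mulr0.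
  by move: ge; rewrite -e ltnNge -ltnS bmdeg.
exists q => [B m|B m sm].
  rewrite qE /co; case: ifP => [/andP[/eqP -> /eqP <-]//|_].
  by rewrite eqxx.
rewrite koszul_coef.
have [eB|nB] := eqVneq #|B| s; last first.
  rewrite /bd big1 ?(introT eqP) //.
    by apply/eqP/contraT => /hz[e]; rewrite e eqxx in nB.
  move=> a; rewrite inE => /andP[aB _].
  by rewrite qE /co cardsU1 aB eqSS (negPf nB) mulr0.
have [eD|nD] := eqVneq (mdeg m + s)%:Z D; last first.
  have -> : (z B)@_m = 0.
    by apply/eqP/contraT => /hz[_ e]; rewrite e eqxx in nD.
  rewrite /bd big1 // => a; rewrite inE => /andP[aB aT].
  rewrite qE /co; case: ifP => [/andP[_ /eqP e]|]; last by rewrite mulr0.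
  case/eqP: nD; rewrite -e; congr Posz; apply/eqP.
  have le : (mesym1 (a |: B) <= m + mesym1 B)%MM.
    rewrite mesym1_supp subUset sub1set aT /= -mesym1_supp; exact: lem_addl.
  rewrite -(eqn_add2r 1) -addnA addn1 -eqSS.
  have := congr1 mdeg (submK le).
  by rewrite !mdegD !mdeg_mesym1 cardsU1 aB eB; lia.
have {1}-> : m = (m + mesym1 B - mesym1 B)%MM by rewrite addmK.
rewrite (yP (m + mesym1 B)%MM) ?addmK ?mdegD ?mdeg_mesym1 ?eB //; last first.
  by rewrite -mesym1_supp lem_addl.
apply: eq_bd => a; rewrite inE => /andP[aB aT].
have le : (mesym1 (a |: B) <= m + mesym1 B)%MM.
  rewrite mesym1_supp subUset sub1set aT /= -mesym1_supp; exact: lem_addl.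
rewrite qE /co submK // cardsU1 aB eB eqxx /= ifT //.
have := congr1 mdeg (submK le).
rewrite !mdegD !mdeg_mesym1 cardsU1 aB eB -eD => e.
by apply/eqP; congr Posz; move: e; lia.
Qed.

Lemma koszul_strand (z : {set 'I_n} -> R^o) (g : 'X_{1..n}) B :
  B \subset mnmsupp g -> bd (mnmsupp g) (fun B' => (z B')@_(g - mesym1 B')) B
   = (koszul z B : R)@_(g - mesym1 B).
Proof.
by rewrite -mesym1_supp => Bg; rewrite koszul_coef submK.
Qed.

Lemma koszul_koszul (z : {set 'I_n} -> R^o) B : koszul (koszul z) B = 0.
Proof.
apply/mpolyP => m; rewrite mcoeff0 koszul_coef.
have Bm : B \subset mnmsupp (m + mesym1 B) by rewrite -mesym1_supp lem_addl.
rewrite -[RHS](bd_bd (mnmsupp (m + mesym1 B))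
  (fun B' => (z B')@_(m + mesym1 B - mesym1 B')) B).
apply: eq_bd => a; rewrite inE => /andP[_ aT].
by rewrite koszul_strand // subUset sub1set aT.
Qed.

(** Every strand of multidegree other than 0 is contracted by any variable of
    its support; the remaining one consists of the constant term at [set0]. *)
Lemma koszul_exact D s (z : {set 'I_n} -> R^o) : hchain D s z ->
    (forall B, koszul z B = 0) -> (z set0)@_0%MM = 0 ->
  exists2 q : {set 'I_n} -> R^o, hchain D s.+1 q & forall B, z B = koszul q B.
Proof.
move=> hz cz z0.
have [|q hq qP] := koszul_lift (std := xpredT) hz; last first.
  by exists q => // B; apply/mpolyP => m; apply: qP.
move=> g _; have [g0|[c cg]] := set_0Vmem (mnmsupp g).
  exists (fun _ => 0) => B _; rewrite g0 subset0 => /eqP -> _.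
  rewrite mesym1_set0 /bd set0D big_set0.
  suff -> : (g - 0)%MM = 0%MM by [].
  apply/mnmP => a; rewrite mnmBE mnm0E subn0; apply/eqP; rewrite -leqn0 leqNgt.
  by have := in_set0 a; rewrite -g0 inE => ->.
have [|||| y yP] := @cone_exact _ _ (mnmsupp g)
   (fun B => B \subset mnmsupp g) _ _ c (fun B => (z B)@_(g - mesym1 B)) cg.
- by [].
- by [].
- by move=> B Bg; apply: subset_trans (subD1set _ _) Bg.
- by move=> B Bg; rewrite koszul_strand // cz mcoeff0.
by exists y => B _ Bg _; apply: yP.
Qed.

Section Quotient.
Context {mu : nat} (s : 'I_mu -> {set 'I_n}) (X : {set 'I_n}).
Context (C O : {set 'I_mu}) (c : 'I_mu -> 'I_n).
Hypothesis sX : forall j, s j \subset X.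
Hypothesis cP : {in C, forall v j : 'I_mu, (c v \in s j) = (j == v)}.
Hypothesis Odisj :
  {in O &, forall v w : 'I_mu, v != w -> [disjoint s v & s w]}.
Hypothesis CO : [disjoint C & O].

Lemma koszul_quot_exact (D : int) i (z : {set 'I_n} -> R^o) : hchain D i z ->
    #|X|%:Z < D - i%:Z + (#|C| + #|O|)%:Z ->
    (forall B m, no_gen s (mnmsupp m) -> (koszul z B : R)@_m = 0) ->
  exists q : {set 'I_n} -> R^o, forall B m, no_gen s (mnmsupp m) ->
    (z B)@_m = (koszul q B : R)@_m.
Proof.
move=> hz lt cz.
have [|q _ qP] := @koszul_lift (fun m => no_gen s (mnmsupp m)) D i z hz.
  2: by exists q.
move=> g gD; set T := mnmsupp g.
pose u B := (z B)@_(g - mesym1 B).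
(* If a^2 divides x^g, removing a from B does not change the support of
   x^g / x^B. *)
have [/existsP[a a2]|] := boolP [exists a, (1 < g a)%N].
  pose P B := (B \subset T) && no_gen s (mnmsupp (g - mesym1 B)).
  have [|||||y yP] := @cone_exact _ _ T P _ _ a u.
  - by move=> B /andP[].
  - move=> B B' /andP[_ h] BB' B'T; rewrite /P B'T; apply: no_genS h.
    apply/subsetP => b; rewrite !inE !mnmBE !mnmE.
    case: (boolP (b \in B)) => [/(subsetP BB') ->//|_]; lia.
  - by rewrite inE; apply: ltnW.
  - move=> B /andP[BT h]; rewrite /P (subset_trans (subD1set _ _) BT).
    apply: no_genS h; apply/subsetP => b; rewrite !inE !mnmBE !mnmE !inE.
    by case: eqVneq => [->|//]; case: (a \in B); lia.
  - by move=> B /andP[BT h]; rewrite koszul_strand // cz.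
  by exists y => B _ BT h; apply: yP; rewrite /P BT.
rewrite negb_exists => /forallP g1.
have gE B : B \subset T -> mnmsupp (g - mesym1 B) = T :\: B.
  move=> BT; apply/setP => b; rewrite !inE mnmBE mnmE.
  by have := g1 b; case: (b \in B); case: (g b) => [|[]].
have cardT : #|T| = mdeg g.
  rewrite mdegE -sum1_card big_mkcond; apply: eq_bigr => b _.
  by rewrite inE; have := g1 b; case: (g b) => [|[]].
have [|y yP] := strand_vanish sX cP Odisj CO (T := T) (u := u).
  by move=> B /andP[BT h]; rewrite koszul_strand // cz ?gE.
exists y => B Bi BT; rewrite gE // => h; apply: yP; first by rewrite /strand BT.
by rewrite cardsDS // Bi cardT; move: lt (subset_leq_card BT);
   rewrite Bi cardT -gD; lia.
Qed.

End Quotient.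
End Koszul.

(** * From a minimal free resolution to the Koszul complex *)

Section HChain.
Context {K : fieldType} {n : nat}.
Local Notation R := {mpoly K[n]}.

Lemma mcoeffM0 (p q : R) : (p * q)@_0%MM = p@_0%MM * q@_0%MM.
Proof. by have [] := mcoeff0_is_multiplicative n K. Qed.

Lemma hchain_sum (I : finType) (D : int) s (z : I -> {set 'I_n} -> R) :
  (forall i, hchain D s (z i)) -> hchain D s (fun B => \sum_i z i B).
Proof.
move=> hz B m; rewrite raddf_sum /=.
have [/existsP[i ni]|] := boolP [exists i, (z i B)@_m != 0].
  by move=> _; apply: hz ni.
rewrite negb_exists => /forallP z0; rewrite big1 ?eqxx // => i _.
by apply/eqP; rewrite -[_ == _]negbK z0.
Qed.

Lemma hchain_mul (D e : int) s (z : {set 'I_n} -> R) (p : R) :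
  hchain D s z -> homog_of_degree e p -> hchain (D + e) s (fun B => z B * p).
Proof.
case: e => [k|k] hz hp B m /=; last first.
  by rewrite (eqP hp) mulr0 mcoeff0 eqxx.
rewrite mcoeffM; set S := (X in X != 0) => S0.
have : [exists k : ('X_{1..n < (mdeg m).+1} * 'X_{1..n < (mdeg m).+1})%type,
   (m == (k.1 + k.2)%MM) && ((z B)@_k.1 * p@_k.2 != 0)].
  apply: contraNT S0; rewrite negb_exists => /forallP h.
  apply/eqP; apply: big1 => i mi; apply/eqP; have := h i.
  by rewrite mi /= negbK.
case/existsP => -[m1 m2] /= /andP[/eqP em].
rewrite mulf_eq0 negb_or => /andP[/hz[eB <-]].
rewrite -mcoeff_msupp => /(dhomogP _ _ _ hp) <-.
by split=> //; move: (congr1 mdeg em); rewrite mdegD /=; lia.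
Qed.

End HChain.

Section Zigzag.
Context {K : fieldType} {n : nat}.
Local Notation R := {mpoly K[n]}.
Context (I : submodClosed R^o) (F : min_free_resolution (@quot_grading K n I)).
Local Notation rk := (res_rank F).
Local Notation dg i := (@res_deg _ _ _ _ F i).
Local Notation diff := (res_diff F).

Lemma aug_lift_ex : exists p : 'I_(rk 0) -> R^o,
  forall l, homog_of_degree (dg 0 l) (p l) /\
    quotmod_pi I (p l) = res_aug F (delta_mx 0 l).
Proof.
have h : forall l, exists p : R^o, homog_of_degree (dg 0 l) p /\
    quotmod_pi I p = res_aug F (delta_mx 0 l).
  by move=> l; have [p hp e] := res_aug_homog (m := F) l; exists p.
by have [p pP] := choice h; exists p.
Qed.

Context (p : 'I_(rk 0) -> R^o).
Hypothesis p_homog : forall l, homog_of_degree (dg 0 l) (p l).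
Hypothesis p_aug : forall l, quotmod_pi I (p l) = res_aug F (delta_mx 0 l).

(** A lift to R of the augmentation, so that statements about R/I become
    congruences modulo I. *)
Definition augl (u : 'rV[R]_(rk 0)) : R^o := \sum_l u 0 l *: p l.

Lemma augl_linear : linear augl.
Proof.
move=> a u v; rewrite /augl scaler_sumr -big_split; apply: eq_bigr => l _ /=.
by rewrite !mxE scalerDl scalerA.
Qed.

Lemma quotmod_pi_linear : linear (quotmod_pi I).
Proof. by move=> a x y; rewrite quotmod_piD -quotmod_piZ. Qed.

Lemma augE u : res_aug F u = quotmod_pi I (augl u).
Proof.
pose G : {linear R^o -> quotmod I} :=
  HB.pack (quotmod_pi I) (GRing.isLinear.Build _ _ _ _ _ quotmod_pi_linear).
rewrite {1}(row_sum_delta u) linear_sum -[quotmod_pi I]/(G : _ -> _).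
rewrite linear_sum; apply: eq_bigr => l _.
by rewrite !linearZ /= p_aug.
Qed.

Lemma quotmod_pi0 : quotmod_pi I 0 = 0.
Proof.
by have := quotmod_piD I 0 0; rewrite addr0 => /eqP;
   rewrite -subr_eq0 opprD addNKr oppr_eq0 => /eqP.
Qed.

Lemma aug_eq0 u : res_aug F u = 0 <-> augl u \in I.
Proof.
by rewrite augE -quotmod_pi0; split=> [/quotmod_piP|h];
   last apply/quotmod_piP; rewrite subr0.
Qed.

Definition vchain (d : int) (s j : nat) (w : {set 'I_n} -> 'rV[R]_(rk j)) :=
  forall l, hchain (d - dg j l) s (fun B => w B 0 l).

(** The chains that go to 0 when both the Koszul differential and the map to
    the previous step of the resolution are applied; at step 0 the latter is
    the augmentation to R/I. *)
Definition bcycle (j : nat) : ({set 'I_n} -> 'rV[R]_(rk j)) -> Prop :=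
  match j with
  | 0 => fun w => forall B, koszul (fun B => augl (w B)) B \in I
  | j'.+1 => fun w => forall B, koszul (fun B => w B *m diff j') B = 0
  end.

Lemma coord_linear (r : nat) (l : 'I_r) :
  linear (fun u : 'rV[R]_r => u 0 l : R^o).
Proof. by move=> a u v; rewrite !mxE. Qed.

Lemma mulmxr_linear (r r' : nat) (A : 'M[R]_(r, r')) :
  linear (fun u : 'rV[R]_r => u *m A).
Proof. by move=> a u v; rewrite mulmxDl scalemxAl. Qed.

Lemma koszul_coord (r : nat) (w : {set 'I_n} -> 'rV[R]_r) (l : 'I_r) B :
  koszul w B 0 l = koszul (fun B => w B 0 l : R^o) B.
Proof. exact: (koszul_linear w B (coord_linear l)). Qed.

Lemma koszul_mulmx (r r' : nat) (w : {set 'I_n} -> 'rV[R]_r)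
    (A : 'M[R]_(r, r')) B :
  koszul w B *m A = koszul (fun B => w B *m A) B.
Proof. exact: (koszul_linear w B (mulmxr_linear A)). Qed.

Lemma bcycle_diff j w w' : (forall B, koszul w' B = w B *m diff j) ->
  bcycle w'.
Proof.
case: j w w' => [|j] w w' e B /=.
  rewrite -(koszul_linear _ _ augl_linear) e; apply/aug_eq0/res_aug_exact.
  by exists (w B).
rewrite -koszul_mulmx e.
by apply/res_diff_exact; exists (w B).
Qed.

Lemma koszul_mem (q : {set 'I_n} -> R^o) B :
  (forall B, q B \in I) -> koszul q B \in I.
Proof. by move=> h; apply: rpred_sum => a _; apply: rpredZ. Qed.

Lemma min_mulmx0 j (u : 'rV[R]_(rk j.+1)) l :
  ((u *m diff j) 0 l)@_0%MM = 0.
Proof.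
rewrite mxE raddf_sum big1 // => k _.
by rewrite /= mcoeffM0 res_minimal mulr0.
Qed.

Context (d : int) (i0 : nat).
Hypothesis van : forall z : {set 'I_n} -> R^o, hchain d i0 z ->
  (forall B, koszul z B \in I) ->
  exists q : {set 'I_n} -> R^o, forall B, z B - koszul q B \in I.

(** By induction on the step [j]: push [w] one step down the resolution, lift
    the result along the Koszul differential to [w'], decompose [w'], and climb
    back.  At step 0 the Koszul cycle lands in R/I, in homological degree [i0]
    and internal degree [d], where it is a boundary by hypothesis. *)
Lemma zigzag j s (w : {set 'I_n} -> 'rV[R]_(rk j)) :
    (j + s)%N = i0 -> vchain d s w -> bcycle w ->
  exists u v, forall B, w B = u B *m diff j + koszul v B.
Proof.
elim: j s w => [|j IH] s w.
  rewrite add0n => -> hw cw.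
  have [|q qP] := van (z := fun B => augl (w B)) _ cw.
    apply: hchain_sum => l.
    have := hchain_mul (hw l) (p_homog l).
    by rewrite subrK.
  have [v vP] := choice (fun B => res_aug_surj F (quotmod_pi I (q B))).
  suff /choice[u uP] : forall B, exists u, w B - koszul v B = u *m diff 0.
    by exists u, v => B; rewrite -uP subrK.
  move=> B; apply/res_aug_exact/aug_eq0.
  pose G : {linear 'rV[R]_(rk 0) -> R^o} :=
    HB.pack augl (GRing.isLinear.Build _ _ _ _ _ augl_linear).
  rewrite -[augl _]/(G _) linearB /= (koszul_linear _ _ augl_linear).
  rewrite -(subrK (koszul q B) (augl (w B))) -addrA -koszulB.
  apply: rpredD => //; apply: koszul_mem => {}B.
  by apply/quotmod_piP; rewrite -augE vP.
move=> jsi hw cw.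
have ex l : exists q : {set 'I_n} -> R^o, hchain (d - dg j l) s.+1 q /\
    forall B, (w B *m diff j) 0 l = koszul q B.
  pose z B : R^o := (w B *m diff j) 0 l.
  have [||| q hq qP] := @koszul_exact K n (d - dg j l) s z.
  - have -> : z = fun B => \sum_k w B 0 k * diff j k l.
      by apply: funext => B; rewrite /z mxE.
    apply: hchain_sum => k.
    have := hchain_mul (hw k) (res_diff_homog (m := F) k l).
    by rewrite addrA subrK.
  - move=> B; rewrite -koszul_coord.
    by rewrite cw mxE.
  - exact: min_mulmx0.
  by exists q.
have [q qP] := choice ex.
pose w' B : 'rV[R]_(rk j) := \row_l q l B.
have w'E B : koszul w' B = w B *m diff j.
  apply/rowP => l; rewrite koszul_coord.
  rewrite (proj2 (qP l)); apply: (@eq_koszul K n R^o).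
  by move=> B'; rewrite mxE.
have [||u' [v' e']] := IH s.+1 w' _ _ (bcycle_diff w'E).
- by rewrite -jsi addnS.
- by move=> l B m; rewrite mxE; apply: (proj1 (qP l)).
suff /choice[u uP] : forall B, exists u, w B - koszul u' B = u *m diff j.+1.
  by exists u, u' => B; rewrite -uP subrK.
move=> B; apply/res_diff_exact.
rewrite mulmxBl -w'E koszul_mulmx -koszulB.
rewrite (eq_koszul (w' := koszul v')) => [|B']; last first.
  by rewrite e' addrAC subrr add0r.
apply/rowP => l; rewrite koszul_coord mxE.
rewrite -[RHS](koszul_koszul (fun B' => v' B' 0 l) B).
by apply: (@eq_koszul K n R^o) => B'; rewrite koszul_coord.
Qed.

(** The zigzag applied to a basis vector of degree [d] would write it as an
    element of (x_1, ..., x_n) F_i0, the image of the differential being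
    contained in it by minimality. *)
Lemma no_generator : #|[set k : 'I_(rk i0) | dg i0 k == d]| = 0%N.
Proof.
apply/eqP; rewrite cards_eq0; apply/eqP/setP => k; rewrite !inE.
apply/negP => /eqP dk.
pose w (B : {set 'I_n}) : 'rV[R]_(rk i0) :=
  if B == set0 then delta_mx 0 k else 0.
have w0 (a : 'I_n) B : w (a |: B) = 0.
  by rewrite /w ifN //; apply/set0Pn; exists a; apply: setU11.
have hw : vchain d 0 w.
  move=> l B m; rewrite /w; case: (eqVneq B set0) => [->|_]; last first.
    by rewrite mxE mcoeff0 eqxx.
  rewrite mxE eqxx /=; case: (eqVneq l k) => [->|_]; last first.
    by rewrite mcoeff0 eqxx.
  rewrite mcoeff1; case: (eqVneq m 0%MM) => [->|_]; last by rewrite eqxx.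
  by rewrite cards0 mdeg0 dk subrr.
have cw : bcycle w.
  case: (i0) w w0 {dk hw} => [|j] w w0 B /=.
    rewrite /koszul big1 ?rpred0 // => a _.
    rewrite w0 /augl big1 ?scaler0 // => l _.
    by rewrite mxE scale0r.
  by rewrite /koszul big1 // => a _; rewrite w0 mul0mx scaler0.
have [u [v /(_ set0)]] := zigzag (addn0 i0) hw cw.
move=> /(congr1 (fun x : 'rV[R]_(rk i0) => (x 0 k)@_0%MM)).
rewrite /w eqxx !mxE !eqxx mcoeff1 eqxx mcoeffD.
rewrite -[X in X + _]/((mcoeff 0%MM (\sum_j _))).
have := min_mulmx0 (u set0) k; rewrite mxE => ->.
rewrite add0r koszul_coord raddf_sum big1 => [/eqP|a _].
  by rewrite oner_eq0.
by rewrite /= !mcoeffM0 mcoeffX -mdeg_eq0 mdeg1 mulr0 mul0r.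
Qed.

End Zigzag.

(** * Square-free monomial ideals *)

Section Membership.
Context {K : fieldType} {n : nat}.
Local Notation R := {mpoly K[n]}.
Implicit Types (I : submodClosed R^o) (m : 'X_{1..n}).

Lemma mem_monomial_ideal (G : set 'X_{1..n}) I (p : R) :
  generates [set 'X_[g] | g in G]%classic I ->
  p \in I <-> forall m, p@_m != 0 -> exists2 g, G g & (g <= m)%MM.
Proof.
move=> gen; split=> [/gen[k [c [g [hg ->]]]] m|h].
  rewrite raddf_sum /=.
  have [/existsP[i ni] _|] := boolP [exists i, (c i * g i)@_m != 0].
    have [u Gu eu] := hg i; move: ni; rewrite -eu commr_mpolyX mcoeffXM.
    by case: ifP => [um _|]; [exists u | rewrite eqxx].
  rewrite negb_exists => /forallP z0; rewrite big1 ?eqxx // => i _.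
  by apply/eqP; rewrite -[_ == _]negbK z0.
rewrite [p]mpolyE big_seq; apply: rpred_sum => m.
rewrite mcoeff_msupp => /h[g Gg gm].
have -> : p@_m *: 'X_[m] = (p@_m *: 'X_[m - g]) *: ('X_[g] : R^o) :> R.
  by rewrite -{2}(submK gm) mpolyXD scalerAl.
apply: rpredZ; apply/gen; exists 1%N, (fun _ => 1), (fun _ => 'X_[g]).
by split=> [_|]; [exists g | rewrite big_ord1 mul1r].
Qed.

(** The given generators may be replaced by their radicals: a square-free
    generator dividing f_j divides every monomial whose support contains that
    of f_j. *)
Lemma mem_squarefree_ideal I mu (f : 'I_mu -> 'X_{1..n}) (p : R) :
  squarefree_monomial_ideal I ->
  generates [set 'X_[f j] | j in [set: 'I_mu]]%classic I ->
  p \in I <->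
  forall m, p@_m != 0 -> ~~ no_gen (fun j => mnmsupp (f j)) (mnmsupp m).
Proof.
move=> [G [Gsf genG]] genf.
have genf' : generates [set 'X_[g] | g in range f]%classic I.
  by rewrite image_comp.
suff eqm m : (exists2 g, range f g & (g <= m)%MM) <->
    ~~ no_gen (fun j => mnmsupp (f j)) (mnmsupp m).
  rewrite (mem_monomial_ideal p genf').
  by split=> h m /h /eqm.
split=> [[_ [j _ <-] /mnm_lepP fm]|].
  rewrite negb_forall; apply/existsP; exists j; rewrite negbK.
  by apply/subsetP => a; rewrite !inE => h; apply: leq_trans h (fm a).
rewrite negb_forall => /existsP[j]; rewrite negbK => /subsetP jm.
have fI : ('X_[f j] : R) \in I.
  apply/(mem_monomial_ideal _ genf') => m'; rewrite mcoeffX.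
  case: (eqVneq (f j) m') => [<- _|_]; last by rewrite eqxx.
  by exists (f j); [exists j | exact: lepm_refl].
have [|g Gg /mnm_lepP gf] := (mem_monomial_ideal _ genG).1 fI (f j).
  by rewrite mcoeffX eqxx oner_eq0.
have gm : (g <= m)%MM.
  apply/mnm_lepP => a; have /forallP/(_ a) := Gsf g Gg.
  have := gf a; have := jm a; rewrite !inE.
  by case: (g a) => [|[|]] // h1 h2 _; apply: h1.
apply: ((mem_monomial_ideal 'X_[m] genf').1 _ m).
  apply/(mem_monomial_ideal _ genG) => m'; rewrite mcoeffX.
  by case: (eqVneq m m') => [<- _|]; [exists g | rewrite eqxx].
by rewrite mcoeffX eqxx oner_eq0.
Qed.

End Membership.

(** * The regularity bound *)

Lemma supremum_le (b : \bar int) (S : set (\bar int)) :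
  (forall z, S z -> (z <= b)%E) -> (supremum -oo%E S <= b)%E.
Proof.
move=> h; rewrite /supremum; case: ifP => _; first exact: leNye.
by case: xgetP => [y _ [_]|_]; [apply | exact: leNye].
Qed.

Theorem theorem4p9 (K : fieldType) (n : nat)
    (I : submodClosed ({mpoly K[n]}^o)%R)
    (hI : squarefree_monomial_ideal I)
    (mu : nat) (f : 'I_mu -> 'X_{1..n}) (hf : min_monomial_generators I f)
    (t : nat) (v : 'I_t -> 'I_mu)
    (hv : isolated_open_vertices
            (add_singletons (lh_edges (ideal_hypergraph f)) v)) :
  (reg (@quot_grading K n I)
     <= (#|lh_X (ideal_hypergraph f)|%:Z - #|lh_V (ideal_hypergraph f)|%:Z
          + t%:Z)%R%:E)%E.
Proof.
set H := ideal_hypergraph f; set X := lh_X H.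
set Es := lh_edges H in hv *; set Es' := add_singletons Es v in hv *.
pose s j := mnmsupp (f j).
have memI p := mem_squarefree_ideal p hI hf.1.
have inE_s j a : (j \in lh_E H a) = (a \in s j).
  by rewrite !inE -mesym1_set1 mesym1_supp sub1set inE.
apply: supremum_le => _ [i [d [bne ->]]]; rewrite lee_fin.
apply/contraT; rewrite -ltNge => lt.
have {bne}[F nF] : exists F : min_free_resolution (@quot_grading K n I),
    #|[set k : 'I_(res_rank F i) | @res_deg _ _ _ _ F i k == d]%SET| != 0%N.
  move: bne; rewrite /betti; case: xgetP => [b _ [F ->]|_]; first by exists F.
  by rewrite eqxx.
have [p pP] := aug_lift_ex F.
suff van (z : {set 'I_n} -> {mpoly K[n]}^o) : hchain d i z ->
    (forall B, koszul z B \in I) ->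
    exists q : {set 'I_n} -> {mpoly K[n]}^o,
      forall B, z B - koszul q B \in I.
  by case/eqP: nF; apply: (no_generator (p := p)) => // l; case: (pP l).
move=> hz cz.
pose C := [set j | closed_vertex Es j]; pose O := [set j | open_vertex Es' j].
(* A generator equal to 1 is treated apart: there need not be any variable to
   serve as a default value of c. *)
have [/existsP[j0 /eqP j00]|] := boolP [exists j, s j == set0].
  exists (fun=> 0) => B; apply/memI => m _; rewrite negb_forall.
  by apply/existsP; exists j0; rewrite negbK -/(s j0) j00 sub0set.
rewrite negb_exists => /forallP sne.
have /choice[c cP] : forall j, exists a, j \in C -> lh_E H a = [set j].
  move=> j; case: (boolP (j \in C)) => [|_].
    by rewrite inE => /imsetP[a _ ->]; exists a.
  by have /set0Pn[a _] := sne j; exists a.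
have sX j : s j \subset X.
  apply/subsetP => a aj; rewrite inE; apply/set0Pn; exists j.
  by rewrite inE_s.
have cs : {in C, forall w j, (c w \in s j) = (j == w)}.
  by move=> w wC j; rewrite -inE_s cP // inE.
have EsS : Es \subset Es' by apply: subsetUl.
have Odisj : {in O &, forall w w' : 'I_mu, w != w' -> [disjoint s w & s w']}.
  move=> w w'; rewrite !inE => wO w'O nw.
  rewrite -setI_eq0; apply/negPn/negP => /set0Pn[a].
  rewrite inE => /andP[aw aw']; move/negP: w'O; apply; apply: (hv w) => //.
  rewrite inE eq_sym nw; apply/existsP; exists (lh_E H a).
  rewrite !inE_s aw aw' !andbT; apply: (subsetP EsS); exact: imset_f.
have CO : [disjoint C & O].
  rewrite disjoints_subset; apply/subsetP => j; rewrite !inE negbK.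
  exact: (subsetP EsS).
have cnt : (mu <= #|C| + #|O| + t)%N.
  rewrite -[X in (X <= _)%N]card_ord -cardsT.
  have -> : [set: 'I_mu] = C :|: O :|: v @: [set: 'I_t].
    apply/setP => j; rewrite !inE.
    case: (boolP (closed_vertex Es j)) => //= nC.
    rewrite /open_vertex; case: (boolP (closed_vertex Es' j)) => //=.
    rewrite /closed_vertex inE; case/orP => [h|].
      by move: nC; rewrite /closed_vertex h.
    by case/imsetP => k _ /set1_inj ->; rewrite imset_f.
  apply: leq_trans (leq_card_setU _ _).1 _; apply: leq_add.
    exact: (leq_card_setU _ _).1.
  by apply: leq_trans (leq_imset_card _ _) _; rewrite cardsT card_ord.
have [||q qP] := koszul_quot_exact sX cs Odisj CO hz.
- by move: lt cnt; rewrite card_ord; move: #|_| (#|_| + _)%N => x y; lia.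
- move=> B m gm; apply/eqP/contraT => ne.
  by have := (memI _).1 (cz B) m ne; rewrite gm.
exists q => B; apply/memI => m; apply: contraNN => gm.
by rewrite mcoeffB qP // subrr.
Qed.
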